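(* For $r>0$ and $A>0$, let $X_{r,A}$ denote a Pareto random variable with probability density function $$f_{r,A}(x)=rA^r\frac{1}{x^{r+1}},\qquad x\ge A.$$ Then for every real $y>0$, $$\inf_{r>2,\,A>0}\mathbf{P}\left(|X_{r,A}-\mathbf{E}[X_{r,A}]|\ge y\sqrt{\mathrm{Var}(X_{r,A})}\right)=0.$$
   Context: $\mathbf{P}$, $\mathbf{E}$ and $\mathrm{Var}$ denote probability, expectation and variance. The density is $0$ outside the indicated range. The variance is finite exactly when $r>2$. *)

(* Defs.v *)
From HB Require Import structures.
From mathcomp Require Import all_boot all_order all_algebra.
From mathcomp Require Import all_classical all_reals all_analysis.
Import Order.TTheory GRing.Theory Num.Theory.
Import numFieldNormedType.Exports.

Set Implicit Arguments.
Unset Strict Implicit.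
Unset Printing Implicit Defensive.

Local Open Scope classical_set_scope.
Local Open Scope ring_scope.

Definition pareto_pdf (R : realType) (r A : R) : R -> R :=
  (fun x => r * A `^ r * (1 / x `^ (r + 1))) \_ `[A, +oo[.

Definition has_density d (T : measurableType d) (R : realType)
    (P : probability T R) (X : {RV P >-> R}) (f : R -> R) : Prop :=
  forall B : set R, measurable B ->
    distribution P X B = (\int[lebesgue_measure]_(x in B) (f x)%:E)%E.

(* Main.v *)
Require Import Defs.
From HB Require Import structures.
From mathcomp Require Import all_boot all_order all_algebra.
From mathcomp Require Import all_classical all_reals all_analysis.
From mathcomp Require Import measurable_realfun ring lra.
Import Order.TTheory GRing.Theory Num.Theory.
Import numFieldNormedType.Exports.
Local Open Scope classical_set_scope.
Local Open Scope ring_scope.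

(** Fix the scale A = 1 and let the shape r decrease to 2.  The mean
    r / (r - 1) then stays below 2, while the second moment r / (r - 2), and
    with it the standard deviation sigma, grows without bound.  The event asks
    the variable to deviate from its mean by y sigma, a quantity that tends to
    infinity, whereas the expected deviation E|X - E X| is at most
    2 E|X| <= 4.  Markov's inequality applied to |X - E X| (and not to its
    square, which would only return the constant 1 / y^2 of Chebyshev) bounds
    the probability by 4 / (y sigma), which tends to 0.

    The moments E|X|^k = r A^k / (r - k) come from [ge0_integral_density],
    which turns an expectation into a Lebesgue integral against the density,
    and from [integral_powR_pinfty], the integral of a power over a half-line.
    They yield square integrability ([pareto_Lfun2]) and the lower bound on
    the variance ([pareto_variance_ge]); the first-order Markov bound is
    [deviation_prob_le]. *)

(** * Powers integrated over a half-line *)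

Lemma cvg_powRN_pinfty (R : realType) (s : R) :
  0 < s -> x `^ (- s) @[x --> +oo] --> (0 : R).
Proof.
move=> s_gt0; apply/cvgrPdist_le => e e_gt0; near=> x.
have x_gt0 : 0 < x by near: x; exact: nbhs_pinfty_gt.
(* The threshold at which x^(-s) equals e. *)
have le_x : e^-1 `^ s^-1 <= x.
  by near: x; apply: nbhs_pinfty_ge; rewrite num_real.
rewrite sub0r normrN ger0_norm ?powR_ge0// powRN.
rewrite -[leRHS]invrK lef_pV2 ?posrE ?invr_gt0 ?powR_gt0//.
have einv_ge0 : 0 <= e^-1 by rewrite invr_ge0 ltW.
rewrite -[leLHS](powRr1 einv_ge0) -(mulVf (lt0r_neq0 s_gt0)) powRrM.
by apply: ge0_ler_powR; rewrite ?nnegrE ?powR_ge0 ?ltW.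
Unshelve. all: end_near. Qed.

(** The exponent is written -s - 1 so that the antiderivative - x^(-s) / s
    vanishes at infinity exactly under the hypothesis 0 < s. *)
Lemma integral_powR_pinfty (R : realType) (s a : R) : 0 < s -> 0 < a ->
  (\int[lebesgue_measure]_(x in `[a, +oo[) (x `^ (- s - 1))%:E)%E
  = (a `^ (- s) / s)%:E.
Proof.
move=> s_gt0 a_gt0.
have s_neq0 := lt0r_neq0 s_gt0.
have cts (p x : R) : 0 < x -> (fun u : R => u `^ p) @ x --> x `^ p.
  move=> x_gt0.
  have d : derivable (fun u : R => u `^ p) x 1.
    by apply: derivable_powR; rewrite in_itv/= andbT.
  have /differentiable_continuous h := (derivable1_diffP _ _).1 d.
  exact: h.
have dF (x : R) : 0 < x ->
    is_derive x 1 (fun x => - s^-1 * x `^ (- s)) (x `^ (- s - 1)).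
  move=> x_gt0; have := is_derive1_powR (- s) x_gt0.
  move=> /(is_deriveZ (- s^-1)) /is_derive_eq; apply.
  by rewrite /GRing.scale/= mulrA mulrNN mulVf ?mul1r.
rewrite (@ge0_continuous_FTC2y _ _ (fun x => - s^-1 * x `^ (- s)) _ 0).
- by rewrite sub0e -EFinN mulNr opprK mulrC.
- by move=> x _; exact: powR_ge0.
- apply/continuous_within_itvcyP; split.
    move=> x; rewrite in_itv/= andbT => /(lt_trans a_gt0); exact: cts.
  by apply: cvg_at_right_filter; exact: cts.
- rewrite -(mulr0 (- s^-1)); apply: cvgM; [exact: cvg_cst|].
  exact: cvg_powRN_pinfty.
- move=> x /(lt_trans a_gt0) /dF dx; exact: (@ex_derive _ _ _ _ _ _ _ dx).
- by apply: cvg_at_right_filter; apply: cvgM; [exact: cvg_cst|exact: cts].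
- move=> x; rewrite in_itv/= andbT => /(lt_trans a_gt0) x_gt0.
  by rewrite derive1E; exact: (@derive_val _ _ _ _ _ _ _ (dF x x_gt0)).
Qed.

(** * Expectations computed from a density *)

Import HBNNSimple.

(** The density gives the law of X on sets, hence the identity for indicators;
    linearity carries it to simple functions, and monotone convergence along an
    increasing sequence of simple functions carries it to g. *)
Lemma ge0_integral_density d (T : measurableType d) (R : realType)
    (P : probability T R) (X : {RV P >-> R}) (f : R -> R) (g : R -> R) :
  has_density X f -> measurable_fun setT f -> (forall x, 0 <= f x) ->
  measurable_fun setT g -> (forall x, 0 <= g x) ->
  (\int[P]_w (g (X w))%:E = \int[lebesgue_measure]_x (g x * f x)%:E)%E.
Proof.
move=> Xf mf f_ge0 mg g_ge0.
have mgE : measurable_fun setT (EFin \o g) by exact/measurable_EFinP.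
under [RHS]eq_integral do rewrite EFinM.
transitivity (\int[distribution P X]_x (g x)%:E)%E.
  by rewrite (ge0_integral_distribution X mgE).
pose h := nnsfun_approx measurableT mgE.
have h_cvg x : (h n x)%:E @[n --> \oo] --> (g x)%:E.
  by apply: cvg_nnsfun_approx => // y _; rewrite /= lee_fin.
have h_nd x : {homo (fun n => h n x) : m n / (m <= n)%N >-> m <= n}.
  by move=> m n mn; exact/lefP/nd_nnsfun_approx.
have mfE : measurable_fun setT (EFin \o f) by exact/measurable_EFinP.
have mh n : measurable_fun setT (EFin \o h n) by exact/measurable_EFinP.
transitivity (limn (fun n => \int[distribution P X]_x (h n x)%:E)%E).
  rewrite -monotone_convergence//.
  - by apply: eq_integral => x _; apply/esym/cvg_lim.
  - by move=> n x _; rewrite lee_fin.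
  - by move=> x _ m n mn; rewrite lee_fin h_nd.
transitivity (limn (fun n =>
    \int[lebesgue_measure]_x ((h n x)%:E * (f x)%:E))%E); last first.
  rewrite -monotone_convergence//.
  - apply: eq_integral => x _; apply/cvg_lim => //.
    by apply: cvgeZr => //.
  - by move=> n; apply: emeasurable_funM; [exact: mh|exact: mfE].
  - by move=> n x _; rewrite mule_ge0 ?lee_fin.
  - by move=> x _ m n mn; rewrite lee_wpmul2r ?lee_fin ?h_nd.
(* Each simple function h n is now a finite sum of multiples of indicators. *)
congr (limn _); apply/funext => n.
have mind y : measurable (h n @^-1` [set y]) by exact: measurable_sfunP.
have mindE r y : measurable_fun setT
    (fun x => (r * \1_(h n @^-1` [set y]) x)%:E).
  by apply/measurable_EFinP; exact: measurable_funM.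
have mind1 y : measurable_fun setT
    (fun x : R => (\1_(h n @^-1` [set y]) x : R)%:E).
  by apply/measurable_EFinP.
under eq_integral do rewrite fimfunE -fsumEFin//.
rewrite ge0_integral_fsum//; last 1 first.
  - by move=> y x _; exact: nnfun_muleindic_ge0.
under [RHS]eq_integral => x _.
  rewrite fimfunE -fsumEFin// ge0_mule_fsuml; last first.
    by move=> y; exact: nnfun_muleindic_ge0.
  over.
rewrite ge0_integral_fsum//; last 2 first.
  - by move=> y; apply: emeasurable_funM; [exact: mindE|exact: mfE].
  - by move=> y x _; apply: mule_ge0;
      [exact: nnfun_muleindic_ge0|rewrite lee_fin].
apply: eq_fsbigr => y /set_mem[x0 _ yE].
have y_ge0 : 0 <= y by rewrite -yE.
under eq_integral do rewrite EFinM.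
under [RHS]eq_integral do rewrite EFinM -muleA.
rewrite ge0_integralZl//.
rewrite [RHS]ge0_integralZl//; last 2 first.
  - by apply: emeasurable_funM; [exact: mind1|exact: mfE].
  - by move=> x _; rewrite mule_ge0 ?lee_fin.
rewrite integral_indic// setIT.
congr (_ * _)%E; apply: (eq_trans (Xf _ (mind y))).
rewrite [LHS]integral_mkcond.
by apply: eq_integral => x _; rewrite epatch_indic muleC.
Qed.

(** * Deviations from the mean *)

Lemma expectation_sqr_Lfun2 d (T : measurableType d) (R : realType)
    (P : probability T R) (X : {RV P >-> R}) :
  ('E_P[fun w => (`|X w| ^+ 2)%R] < +oo)%E -> (X : T -> R) \in Lfun P 2%:E.
Proof.
move=> EX2; rewrite inE; apply/andP; split; rewrite inE/=.
  exact: measurable_funPT.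
rewrite /finite_norm unlock /=; apply: poweR_lty.
move: EX2; rewrite unlock; congr (_ < _)%E.
by apply: eq_integral => w _; rewrite /= powR_mulrn.
Qed.

(** Markov's inequality of order one for X - E X, together with
    E|X - E X| <= E|X| + |E X| <= 2 E|X|. *)
Lemma markov_deviation d (T : measurableType d) (R : realType)
    (P : probability T R) (X : {RV P >-> R}) (t : R) :
  0 < t -> (X : T -> R) \in Lfun P 1 ->
  (t%:E * P [set w | t%:E <= `|(X w)%:E - 'E_P[X]|]
     <= 2%:E * 'E_P[fun w => `|X w|%R])%E.
Proof.
move=> t_gt0 X1; have Efin := expectation_fin_num X1.
set m := fine 'E_P[X]%E.
have mE : ('E_P[X] = m%:E)%E by rewrite fineK.
pose Y : {RV P >-> R} := (X \- cst m)%R.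
have := @markov _ _ _ P Y idfun t t_gt0.
move=> /(_ (@measurable_id _ _ _) (fun _ => id) (fun _ _ _ _ => id)).
have -> : [set w | (t%:E <= `|(Y w)%:E|)%E] =
          [set w | (t%:E <= `|(X w)%:E - 'E_P[X]|)%E] by rewrite mE.
move/le_trans; apply.
have aX1 : (fun w => `|X w|) \in Lfun P 1 by exact: Lfun_norm.
apply: (@le_trans _ _ ('E_P[((fun w => `|X w|) \+ cst `|m|)%R])%E).
  apply: expectation_le => //=.
  - by apply: measurableT_comp => //; exact: measurableT_comp.
  - by apply: measurable_funD => //; exact: measurableT_comp.
  - by apply: aeW => w /=; exact: ler_normB.
rewrite expectationD ?Lfun_cst// expectation_cst -[2]/(1 + 1) EFinD muleDl//.
rewrite mul1e leeD2l// -abse_EFin -mE unlock.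
  by apply: le_abse_integral => //; exact/measurable_EFinP.
exact: expectation_fin_num aX1.
Qed.

(** Raising the threshold from y sqrt v to y sigma shrinks the event, so the
    first-order Markov bound at y sqrt v applies. *)
Lemma deviation_prob_le d (T : measurableType d) (R : realType)
    (P : probability T R) (X : {RV P >-> R}) (y v c : R) :
  0 < y -> 0 < v -> (X : T -> R) \in Lfun P 2%:E ->
  (v%:E <= 'V_P[X])%E -> ('E_P[fun w => `|X w|%R] <= c%:E)%E ->
  (P [set w | (y%:E * sqrte 'V_P[X] <= `|(X w)%:E - 'E_P[X]|)%E]
     <= (2 * c / (y * Num.sqrt v))%:E)%E.
Proof.
move=> y_gt0 v_gt0 X2 vV Xc.
have X1 : (X : T -> R) \in Lfun P 1.
  by exact: Lfun_subset12 (fin_num_measure _ _ _) _ X2.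
have t_gt0 : 0 < y * Num.sqrt v by rewrite mulr_gt0 ?sqrtr_gt0.
have mE : 'E_P[X]%E \is a fin_num by exact: expectation_fin_num.
have mX : measurable_fun setT (fun w => `|(X w)%:E - 'E_P[X]|%E).
  apply: measurableT_comp => //; apply: emeasurable_funB => //.
  exact/measurable_EFinP.
have mS (a : \bar R) : measurable [set w | (a <= `|(X w)%:E - 'E_P[X]|)%E].
  have := emeasurable_fun_c_infty measurableT mX a; by rewrite setTI.
apply: (@le_trans _ _
  (P [set w | ((y * Num.sqrt v)%:E <= `|(X w)%:E - 'E_P[X]|)%E])).
  rewrite le_measure ?inE// => w /=; apply: le_trans.
  by rewrite EFinM lee_pmul2l ?lte_fin// -[(Num.sqrt v)%:E]/(sqrte v%:E)
    lee_sqrt// variance_ge0.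
rewrite -(@lee_pmul2l _ (y * Num.sqrt v)%:E) ?lte_fin//.
rewrite (le_trans (markov_deviation _ _ _ _ X _ t_gt0 X1))//.
rewrite -EFinM mulrCA divff ?mulr1 ?lt0r_neq0// EFinM.
by rewrite lee_pmul2l ?lte_fin.
Qed.

(** * Moments of the Pareto law *)

Lemma pareto_pdf_ge0 (R : realType) (r A x : R) :
  0 <= r -> 0 <= pareto_pdf r A x.
Proof.
move=> r_ge0; apply: restrict_ge0 => {}x _.
by rewrite div1r !mulr_ge0 ?powR_ge0 ?invr_ge0 ?powR_ge0.
Qed.

Lemma measurable_pareto_pdf (R : realType) (r A : R) :
  measurable_fun setT (pareto_pdf r A).
Proof.
apply/measurable_restrict => //; apply: measurable_funTS.
apply: measurable_funM => //; under eq_fun do rewrite div1r -powRN.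
exact: measurable_powR.
Qed.

(** On the support, |x|^k times the density is the multiple r A^r of the power
    of exponent -(r - k) - 1, whose integral is finite because k < r.  Absolute
    values make the integrand nonnegative on the whole line, so no
    integrability has to be established beforehand. *)
Lemma pareto_moment d (T : measurableType d) (R : realType)
    (P : probability T R) (X : {RV P >-> R}) (r A : R) (k : nat) :
  k%:R < r -> 0 < A -> has_density X (pareto_pdf r A) ->
  ('E_P[fun w => (`|X w| ^+ k)%R] = (r * A ^+ k / (r - k%:R))%:E)%E.
Proof.
move=> kr A_gt0 Xr.
have r_ge0 : 0 <= r by rewrite (le_trans _ (ltW kr)).
rewrite unlock.
rewrite (@ge0_integral_density _ _ _ P X _ (fun x => `|x| ^+ k) Xr);
  last 4 first.
- exact: measurable_pareto_pdf.
- by move=> x; exact: pareto_pdf_ge0.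
- by apply: measurable_funX; exact: normr_measurable.
- by move=> x; rewrite exprn_ge0.
pose s := r - k%:R.
have s_gt0 : 0 < s by rewrite subr_gt0.
transitivity (\int[lebesgue_measure]_(x in `[A, +oo[)
    ((r * A `^ r)%:E * (x `^ (- s - 1))%:E))%E.
  rewrite [RHS]integral_mkcond; apply: eq_integral => x _.
  rewrite /pareto_pdf !patchE; case: ifPn => [|_]; last by rewrite mulr0.
  rewrite inE/= in_itv/= andbT => Ax; have x_gt0 := lt_le_trans A_gt0 Ax.
  rewrite -EFinM (ger0_norm (ltW x_gt0)) -powR_mulrn ?ltW// div1r -powRN.
  rewrite mulrCA -powRD; last by rewrite (lt0r_neq0 x_gt0) implybT.
  by congr (_ * _ `^ _)%:E; rewrite /s; ring.
rewrite ge0_integralZl//; last 3 first.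
- apply/measurable_EFinP; apply: measurable_funTS; exact: measurable_powR.
- by move=> x _; rewrite lee_fin powR_ge0.
- by rewrite lee_fin mulr_ge0 ?powR_ge0.
rewrite integral_powR_pinfty// -EFinM; congr EFin.
rewrite -powR_mulrn ?ltW// mulrA -[X in X / _]mulrA -powRD; last first.
  by rewrite (lt0r_neq0 A_gt0) implybT.
by congr (_ * _ `^ _ / _); rewrite /s; ring.
Qed.

Lemma pareto_Lfun2 d (T : measurableType d) (R : realType)
    (P : probability T R) (X : {RV P >-> R}) (r A : R) :
  2 < r -> 0 < A -> has_density X (pareto_pdf r A) ->
  (X : T -> R) \in Lfun P 2%:E.
Proof.
move=> r_gt2 A_gt0 Xr; apply: expectation_sqr_Lfun2.
by rewrite (@pareto_moment _ _ _ _ _ _ _ 2 r_gt2 A_gt0 Xr) ltry.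
Qed.

(** The right-hand side is the actual variance r A^2 / ((r - 1)^2 (r - 2)).
    The inequality comes from (E X)^2 <= (E|X|)^2, since the moments at hand
    are those of |X|. *)
Lemma pareto_variance_ge d (T : measurableType d) (R : realType)
    (P : probability T R) (X : {RV P >-> R}) (r A : R) :
  2 < r -> 0 < A -> has_density X (pareto_pdf r A) ->
  (((r * A ^+ 2 / (r - 2)) - (r * A / (r - 1)) ^+ 2)%:E <= 'V_P[X])%E.
Proof.
move=> r_gt2 A_gt0 Xr.
have m1 := @pareto_moment _ _ _ _ _ _ _ 1 (lt_trans (ltr1n R 2) r_gt2) A_gt0 Xr.
have m2 := @pareto_moment _ _ _ _ _ _ _ 2 r_gt2 A_gt0 Xr.
have X2 := @pareto_Lfun2 _ _ _ _ _ _ _ r_gt2 A_gt0 Xr.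
have X1 : (X : T -> R) \in Lfun P 1.
  by exact: Lfun_subset12 (fin_num_measure _ _ _) _ X2.
have mE : 'E_P[X]%E \is a fin_num by exact: expectation_fin_num.
rewrite varianceE//.
have -> : ('E_P[(X ^+ 2)%R] = (r * A ^+ 2 / (r - 2))%:E)%E.
  rewrite -m2; congr expectation; apply/funext => w.
  by rewrite real_normK ?num_real.
rewrite -(fineK mE) -EFin_expe -EFinB lee_fin lerD2l lerN2.
rewrite -[leLHS]real_normK ?num_real// lerXn2r ?nnegrE//.
  by rewrite !mulr_ge0 ?invr_ge0; lra.
rewrite -lee_fin -abse_EFin fineK// -[A in leRHS]expr1 -m1 unlock.
by apply: le_abse_integral => //; exact/measurable_EFinP.
Qed.

(** * The infimum *)

Theorem proposition3p6 (R : realType)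
    (d : R -> R -> measure_display)
    (T : forall r A : R, measurableType (d r A))
    (P : forall r A : R, probability (T r A) R)
    (X : forall r A : R, {RV (P r A) >-> R})
    (X_pareto : forall r A : R, 0 < r -> 0 < A ->
       has_density (X r A) (pareto_pdf r A))
    (y : R) (y_gt0 : 0 < y) :
  ereal_inf [set p : \bar R | exists r A : R, [/\ 2 < r, 0 < A &
    p = P r A [set w : T r A |
      (y%:E * sqrte 'V_(P r A)[X r A]
         <= `| (X r A w)%:E - 'E_(P r A)[X r A] |)%E ] ]] = 0%E.
Proof.
apply/eqP; rewrite eq_le; apply/andP; split; last first.
  by apply: le_ereal_inf_tmp => _ [r [A [_ _ ->]]]; exact: measure_ge0.
apply/lee_addgt0Pr => e e_gt0; rewrite add0e.
(* v solves 4 / (y sqrt v) = e, and r makes the second moment equal v + 5. *)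
pose v := (4 / (y * e)) ^+ 2.
have sqrt_v : Num.sqrt v = 4 / (y * e).
  by rewrite sqrtr_sqr ger0_norm// divr_ge0// mulr_ge0 ?ltW.
have v_gt0 : 0 < v by rewrite exprn_gt0// divr_gt0// mulr_gt0.
pose r := 2 + 2 / (4 + v).
have r_gt2 : 2 < r by rewrite ltrDl divr_gt0//; lra.
have r_gt0 : 0 < r by lra.
have Xr := X_pareto r 1 r_gt0 ltr01.
apply: le_trans; first by apply: ereal_inf_lbound; exists r, 1; split.
have mean_le2 : r / (r - 1) <= 2.
  by rewrite ler_pdivrMr; lra.
have EX : ('E_(P r 1%R)[fun w => `|X r 1 w|%R] <= 2%:E)%E.
  have r_gt1 : 1 < r by lra.
  rewrite (@pareto_moment _ _ _ _ _ _ _ 1 r_gt1 ltr01 Xr).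
  by rewrite expr1n mulr1 lee_fin.
have vV : (v%:E <= 'V_(P r 1%R)[X r 1%R])%E.
  apply: le_trans (@pareto_variance_ge _ _ _ _ _ _ _ r_gt2 ltr01 Xr).
  rewrite expr1n !mulr1 lee_fin.
  have -> : r / (r - 2) = 5 + v by rewrite /r; field; apply/andP; split; lra.
  have : (r / (r - 1)) ^+ 2 <= 2 ^+ 2.
    by rewrite lerXn2r ?nnegrE// divr_ge0; lra.
  by lra.
have X2 := @pareto_Lfun2 _ _ _ _ _ _ _ r_gt2 ltr01 Xr.
apply: (le_trans (@deviation_prob_le _ _ _ _ _ _ _ _ y_gt0 v_gt0 X2 vV EX)).
rewrite sqrt_v lee_fin le_eqVlt; apply/orP; left; apply/eqP.
by field; rewrite !lt0r_neq0.
Qed.
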